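(* For every parameter vector $\bm{\theta}\in\mathbb{R}^D$, the gradient of the trace of the squared loss Hessian with respect to the hidden-to-output parameters $\bm{v}$ is $$\frac{\partial\,\mathrm{tr}(\bm{H}_L(\bm{\theta})^2)}{\partial\bm{v}}=2\sum_{i=1}^I\sum_{j=1}^I\sum_{a\in\{\Phi,\Psi,\Omega\}}\bm{\mathcal{V}}_{ij}^a\in\mathbb{R}^{N+1},\qquad \bm{\mathcal{V}}_{ij}^a=\bm{\mathcal{C}}_{ij}^a+\bm{\mathcal{D}}_{ij}^a\in\mathbb{R}^{N+1},$$ where $$\bm{\mathcal{C}}_{ij}^\Phi=(1+\bm{x}_i^\top\bm{x}_j)^2\bm{K}_{ij}^\Phi(\bm{o}_i\otimes\bm{o}_j),\qquad \bm{\mathcal{C}}_{ij}^\Psi=2(1+\bm{x}_i^\top\bm{x}_j)\bm{K}_{ij}^\Psi(\bm{o}_i\otimes\bm{o}_j),$$ $$\bm{\mathcal{C}}_{ij}^\Omega=s''(z_i)s'(z_j)(1+\bm{f}(\bm{y}_i)^\top\bm{f}(\bm{y}_j))^2\bm{h}(\bm{f}(\bm{y}_i)),$$ $$\bm{\mathcal{D}}_{ij}^\Phi=(1+\bm{x}_i^\top\bm{x}_j)^2\,\bm{h}(\bm{f}(\bm{y}_i))\bm{s}^{\prime\prime/\prime}(z_i)^\top\bm{\Phi}_{ij}\bm{o}_j,\qquad \bm{\mathcal{D}}_{ij}^\Psi=2(1+\bm{x}_i^\top\bm{x}_j)\,\bm{h}(\bm{f}(\bm{y}_i))\bm{s}^{\prime\prime/\prime}(z_i)^\top\bm{\Psi}_{ij}\bm{o}_j,\qquad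 \bm{\mathcal{D}}_{ij}^\Omega=\bm{0}_{N+1}.$$ Here $\bm{K}_{ij}^\Phi=[\bm{\mathfrak{e}}^\Phi_{ij}\ \ \bm{\mathfrak{f}}^\Phi_{ij}\ \ \bm{0}_{N+1}\ \ \bm{\mathfrak{g}}^\Phi_{ij}]\in\mathbb{R}^{(N+1)\times4}$ with $$\bm{\mathfrak{e}}^\Phi_{ij}=2(\bm{\Phi}_{ij})_{11}^{1/2}\,\bm{V}^\top\odot\bm{f}'_0(\bm{y}_j)\odot\bm{f}'_0(\bm{y}_i),\qquad \bm{\mathfrak{f}}^\Phi_{ij}=3\bm{V}^{\odot2\top}\odot\bm{f}'_0(\bm{y}_i)^{\odot2}\odot\bm{f}''_0(\bm{y}_j),\qquad \bm{\mathfrak{g}}^\Phi_{ij}=\bm{V}^\top\odot\bm{f}''_0(\bm{y}_i)\odot\bm{f}''_0(\bm{y}_j),$$ and $\bm{K}_{ij}^\Psi=[\bm{\mathfrak{e}}^\Psi_{ij}\ \ \bm{\mathfrak{f}}^\Psi_{ij}\ \ \bm{0}_{N+1}\ \ \bm{0}_{N+1}]\in\mathbb{R}^{(N+1)\times4}$ with $$\bm{\mathfrak{e}}^\Psi_{ij}=(1+\bm{f}(\bm{y}_i)^\top\bm{f}(\bm{y}_j))\bm{F}'_0(\bm{y}_i)\bm{F}'(\bm{y}_j)\widetilde{\bm{V}}^\top,\qquad \bm{\mathfrak{f}}^\Psi_{ij}=\bm{F}'_0(\bm{y}_i)\bm{F}'(\bm{y}_j)\bm{f}(\bm{y}_i)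.$$
   Context: Network. Let $M,N,I\ge 1$ be integers and $f:\mathbb{R}\to\mathbb{R}$ a three times differentiable activation function with derivatives $f',f'',f'''$. For $\bm{y}\in\mathbb{R}^N$: $\bm{f}(\bm{y})=[f(y_1),\dots,f(y_N)]^\top$, and $\bm{f}',\bm{f}''$ are defined entrywise in the same way; $\bm{F}'(\bm{y})=\mathrm{diag}(\bm{f}'(\bm{y}))$, $\bm{F}''(\bm{y})=\mathrm{diag}(\bm{f}''(\bm{y}))$; $\bm{f}'_0(\bm{y}),\bm{f}''_0(\bm{y})\in\mathbb{R}^{N+1}$ are $\bm{f}'(\bm{y}),\bm{f}''(\bm{y})$ with an entry $0$ prepended; $\bm{F}'_0(\bm{y})\in\mathbb{R}^{(N+1)\times N}$ is $\bm{F}'(\bm{y})$ with a zero row prepended on top. For a vector $\bm{u}$, $\bm{h}(\bm{u})=[1\ \ \bm{u}^\top]^\top$. Parameters: $\bm{W}=[\bm{b}\ \ \widetilde{\bm{W}}]\in\mathbb{R}^{N\times(M+1)}$ with $\bm{b}\in\mathbb{R}^N$, $\widetilde{\bm{W}}\in\mathbb{R}^{N\times M}$, and $\bm{V}=[c\ \ \widetilde{\bm{V}}]\in\mathbb{R}^{1\times(N+1)}$ with $c\in\mathbb{R}$, $\widetilde{\bm{V}}\in\mathbb{R}^{1\times N}$. Let $\bm{w}\in\mathbb{R}^{(M+1)N}$ be the vertical concatenation of the columns of $\bm{W}$ (in order), $\bm{v}=\bm{V}^\top\in\mathbb{R}^{N+1}$, and $\bm{\theta}=[\bm{w}^\top\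 \bm{v}^\top]^\top\in\mathbb{R}^D$, $D=MN+2N+1$. For training data $\bm{x}_i\in\mathbb{R}^M$ with labels $q_i\in\{0,1\}$, $i=1,\dots,I$, put $\bm{y}_i=\bm{W}\bm{h}(\bm{x}_i)$, $z_i=\bm{V}\bm{h}(\bm{f}(\bm{y}_i))$, $p_i=s(z_i)$, where $s(z)=1/(1+e^{-z})$; then $s'(z_i)=p_i(1-p_i)$, $s''(z_i)=(1-2p_i)(1-p_i)p_i$; and $\delta_i=p_i-q_i$. Loss: $L(\bm{\theta})=-\sum_{i=1}^I\big(q_i\log p_i+(1-q_i)\log(1-p_i)\big)$. $\bm{H}_L(\bm{\theta})\in\mathbb{R}^{D\times D}$ is the Hessian of $L$ with respect to $\bm{\theta}$. Auxiliary quantities: $\bm{o}_i=[s'(z_i)\ \ \delta_i]^\top$, $\bm{s}^{\prime\prime/\prime}(z)=[s''(z)\ \ s'(z)]^\top$. The $2\times2$ matrix $\bm{\Phi}_{ij}$ has entries $(\bm{\Phi}_{ij})_{11}=(\widetilde{\bm{V}}\bm{F}'(\bm{y}_j)\bm{F}'(\bm{y}_i)\widetilde{\bm{V}}^\top)^2$, $(\bm{\Phi}_{ij})_{12}=\widetilde{\bm{V}}\bm{F}'(\bm{y}_i)\mathrm{diag}(\widetilde{\bm{V}}^\top)\bm{F}''(\bm{y}_j)\bm{F}'(\bm{y}_i)\widetilde{\bm{V}}^\top$, $(\bm{\Phi}_{ij})_{21}=\widetilde{\bm{V}}\bm{F}'(\bm{y}_j)\mathrm{diag}(\widetilde{\bm{V}}^\top)\bm{F}''(\bm{y}_i)\bm{F}'(\bm{y}_j)\widetilde{\bm{V}}^\top$,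 $(\bm{\Phi}_{ij})_{22}=\widetilde{\bm{V}}\bm{F}''(\bm{y}_i)\bm{F}''(\bm{y}_j)\widetilde{\bm{V}}^\top$; and $(\bm{\Phi}_{ij})_{11}^{1/2}$ denotes $\widetilde{\bm{V}}\bm{F}'(\bm{y}_j)\bm{F}'(\bm{y}_i)\widetilde{\bm{V}}^\top$ (with its sign). The $2\times2$ matrix $\bm{\Psi}_{ij}$ has entries $(\bm{\Psi}_{ij})_{11}=(1+\bm{f}(\bm{y}_i)^\top\bm{f}(\bm{y}_j))\widetilde{\bm{V}}\bm{F}'(\bm{y}_j)\bm{F}'(\bm{y}_i)\widetilde{\bm{V}}^\top$, $(\bm{\Psi}_{ij})_{12}=\bm{f}(\bm{y}_i)^\top\bm{F}'(\bm{y}_j)\bm{F}'(\bm{y}_i)\widetilde{\bm{V}}^\top$, $(\bm{\Psi}_{ij})_{21}=\widetilde{\bm{V}}\bm{F}'(\bm{y}_j)\bm{F}'(\bm{y}_i)\bm{f}(\bm{y}_j)$, $(\bm{\Psi}_{ij})_{22}=\bm{f}'(\bm{y}_i)^\top\bm{f}'(\bm{y}_j)$. The gradient of a scalar function is the column vector of its partial derivatives; $\otimes$ is the Kronecker product, $\odot$ the entrywise product, $(\cdot)^{\odot k}$ the entrywise $k$-th power, $\bm{V}^{\odot 2\top}$ the column vector of squared entries of $\bm{V}$, and $\bm{0}_{N+1}$ the zero vector of $\mathbb{R}^{N+1}$. *)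

(* Defs.v *)
From mathcomp Require Import all_boot all_order all_algebra.
From mathcomp Require Import all_classical all_reals all_analysis.
From mathcomp Require Export mxtens.
Import GRing.Theory Num.Theory.
Import numFieldNormedType.Exports.

Set Implicit Arguments.
Unset Strict Implicit.
Unset Printing Implicit Defensive.

Local Open Scope ring_scope.
Local Open Scope classical_set_scope.

Section Calculus.
Variable R : realType.

Definition thrice_differentiable (f : R -> R) : Prop :=
  forall (k : nat) (t : R), (k < 3)%N -> derivable (f^`(k)) t 1.

(* [is_derive] asserts that each partial derivative exists and has the given
   value, so the default value of ['D_v] is never used as a gradient. *)
Definition is_gradient (n : nat) (g : 'cV[R]_n -> R) (a G : 'cV[R]_n) : Prop :=
  forall k : 'I_n, is_derive a (delta_mx k 0 : 'cV[R]_n) g (G k 0).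

Definition partial (n : nat) (k : 'I_n) (g : 'cV[R]_n -> R) (a : 'cV[R]_n) : R :=
  'D_(delta_mx k 0) g a.

Definition hessian (n : nat) (g : 'cV[R]_n -> R) (a : 'cV[R]_n) : 'M[R]_n :=
  \matrix_(k, l) partial k (partial l g) a.

Definition sigmoid (t : R) : R := (1 + expR (- t))^-1.

End Calculus.

Section Matrices.
Variable R : realType.

Definition scalar_of (A : 'M[R]_1) : R := A 0 0.

Definition hadamard (m n : nat) (A B : 'M[R]_(m, n)) : 'M[R]_(m, n) :=
  map2_mx *%R A B.

Definition hadamard_exp (m n : nat) (A : 'M[R]_(m, n)) (k : nat) :
    'M[R]_(m, n) :=
  map_mx (fun a => a ^+ k) A.

Definition vec2 (a b : R) : 'cV[R]_2 :=
  col_mx (a%:M : 'M[R]_1) (b%:M : 'M[R]_1).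

Definition mx22 (a b c d : R) : 'M[R]_2 :=
  block_mx (a%:M : 'M[R]_1) (b%:M : 'M[R]_1) (c%:M : 'M[R]_1) (d%:M : 'M[R]_1).

Definition cols4 (m : nat) (a b c d : 'cV[R]_m) : 'M[R]_(m, 4) :=
  row_mx a (row_mx b (row_mx c d)).

Definition diagc (n : nat) (u : 'cV[R]_n) : 'M[R]_n := diag_mx u^T.

Definition haug (n : nat) (u : 'cV[R]_n) : 'cV[R]_(1 + n) := col_mx 1%:M u.

End Matrices.

Notation "A '*h' B" := (hadamard A B)
  (at level 40, left associativity) : ring_scope.

Section Network.
Variables (R : realType) (M N nI : nat).

Notation dim_w := ((1 + M) * N)%N.
Notation dim_v := (1 + N)%N.
Notation dim_theta := (dim_w + dim_v)%N.

Section ParamVector.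
Variable theta : 'cV[R]_dim_theta.

Definition wpart : 'cV[R]_dim_w := usubmx theta.
Definition vpart : 'cV[R]_dim_v := dsubmx theta.

(* [vec_mx] fills a matrix row by row, whereas w stacks the columns of W;
   hence the transposition. *)
Definition Wmx : 'M[R]_(N, 1 + M) := (vec_mx wpart^T)^T.
Definition Vmx : 'rV[R]_(1 + N) := vpart^T.
Definition Vtilde : 'rV[R]_N := rsubmx Vmx.

End ParamVector.

Variables (f : R -> R) (x : 'I_nI -> 'cV[R]_M).

Definition fvec (y : 'cV[R]_N) : 'cV[R]_N := map_mx f y.
Definition f1vec (y : 'cV[R]_N) : 'cV[R]_N := map_mx (f^`()) y.
Definition f2vec (y : 'cV[R]_N) : 'cV[R]_N := map_mx (f^`(2)) y.
Definition F1 (y : 'cV[R]_N) : 'M[R]_N := diagc (f1vec y).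
Definition F2 (y : 'cV[R]_N) : 'M[R]_N := diagc (f2vec y).
Definition f1vec0 (y : 'cV[R]_N) : 'cV[R]_(1 + N) := col_mx 0 (f1vec y).
Definition f2vec0 (y : 'cV[R]_N) : 'cV[R]_(1 + N) := col_mx 0 (f2vec y).
Definition F10 (y : 'cV[R]_N) : 'M[R]_(1 + N, N) := col_mx 0 (F1 y).

Definition yvec (theta : 'cV[R]_dim_theta) (i : 'I_nI) : 'cV[R]_N :=
  Wmx theta *m haug (x i).

Definition zval (theta : 'cV[R]_dim_theta) (i : 'I_nI) : R :=
  scalar_of (Vmx theta *m haug (fvec (yvec theta i))).

Definition pval (theta : 'cV[R]_dim_theta) (i : 'I_nI) : R :=
  sigmoid (zval theta i).

Variable q : 'I_nI -> bool.

Definition loss (theta : 'cV[R]_dim_theta) : R :=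
  - \sum_(i < nI) ((q i)%:R * ln (pval theta i)
                   + (1 - (q i)%:R) * ln (1 - pval theta i)).

Section AuxiliaryQuantities.
Variable theta : 'cV[R]_dim_theta.

Local Notation V := (Vmx theta).
Local Notation Vt := (Vtilde theta).
Local Notation y := (yvec theta).
Local Notation z := (zval theta).

Definition delta (i : 'I_nI) : R := pval theta i - (q i)%:R.

Definition sig1 (i : 'I_nI) : R := (@sigmoid R)^`()%classic (z i).
Definition sig2 (i : 'I_nI) : R := (@sigmoid R)^`(2)%classic (z i).

Definition ovec (i : 'I_nI) : 'cV[R]_2 := vec2 (sig1 i) (delta i).
(* The vector of s'' and s' at z_i, in this order. *)
Definition svec (i : 'I_nI) : 'cV[R]_2 := vec2 (sig2 i) (sig1 i).

Definition xdot (i j : 'I_nI) : R := 1 + scalar_of ((x i)^T *m x j).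
Definition fdot (i j : 'I_nI) : R :=
  1 + scalar_of ((fvec (y i))^T *m fvec (y j)).

(* The signed square root of the (1,1) entry of Phi. *)
Definition Phi11_half (i j : 'I_nI) : R :=
  scalar_of (Vt *m F1 (y j) *m F1 (y i) *m Vt^T).

Definition Phi (i j : 'I_nI) : 'M[R]_2 :=
  mx22 (Phi11_half i j ^+ 2)
       (scalar_of
          (Vt *m F1 (y i) *m diagc Vt^T *m F2 (y j) *m F1 (y i) *m Vt^T))
       (scalar_of
          (Vt *m F1 (y j) *m diagc Vt^T *m F2 (y i) *m F1 (y j) *m Vt^T))
       (scalar_of (Vt *m F2 (y i) *m F2 (y j) *m Vt^T)).

Definition Psi (i j : 'I_nI) : 'M[R]_2 :=
  mx22 (fdot i j * scalar_of (Vt *m F1 (y j) *m F1 (y i) *m Vt^T))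
       (scalar_of ((fvec (y i))^T *m F1 (y j) *m F1 (y i) *m Vt^T))
       (scalar_of (Vt *m F1 (y j) *m F1 (y i) *m fvec (y j)))
       (scalar_of ((f1vec (y i))^T *m f1vec (y j))).

Definition ePhi (i j : 'I_nI) : 'cV[R]_dim_v :=
  (2 * Phi11_half i j) *: (V^T *h f1vec0 (y j) *h f1vec0 (y i)).
Definition fPhi (i j : 'I_nI) : 'cV[R]_dim_v :=
  3 *: ((hadamard_exp V 2)^T *h hadamard_exp (f1vec0 (y i)) 2
        *h f2vec0 (y j)).
Definition gPhi (i j : 'I_nI) : 'cV[R]_dim_v :=
  V^T *h f2vec0 (y i) *h f2vec0 (y j).
Definition KPhi (i j : 'I_nI) : 'M[R]_(dim_v, 4) :=
  cols4 (ePhi i j) (fPhi i j) 0 (gPhi i j).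

Definition ePsi (i j : 'I_nI) : 'cV[R]_dim_v :=
  fdot i j *: (F10 (y i) *m F1 (y j) *m Vt^T).
Definition fPsi (i j : 'I_nI) : 'cV[R]_dim_v :=
  F10 (y i) *m F1 (y j) *m fvec (y i).
Definition KPsi (i j : 'I_nI) : 'M[R]_(dim_v, 4) :=
  cols4 (ePsi i j) (fPsi i j) 0 0.

(* [*t] is the Kronecker product; its dimensions 2 * 2 and 1 * 1 are
   convertible to 4 and 1. *)
Definition oo (i j : 'I_nI) : 'cV[R]_4 := ovec i *t ovec j.

Definition CPhi (i j : 'I_nI) : 'cV[R]_dim_v :=
  (xdot i j ^+ 2) *: (KPhi i j *m oo i j).
Definition CPsi (i j : 'I_nI) : 'cV[R]_dim_v :=
  (2 * xdot i j) *: (KPsi i j *m oo i j).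
Definition COmega (i j : 'I_nI) : 'cV[R]_dim_v :=
  (sig2 i * sig1 j * fdot i j ^+ 2) *: haug (fvec (y i)).

Definition DPhi (i j : 'I_nI) : 'cV[R]_dim_v :=
  (xdot i j ^+ 2) *:
    (haug (fvec (y i)) *m (svec i)^T *m Phi i j *m ovec j).
Definition DPsi (i j : 'I_nI) : 'cV[R]_dim_v :=
  (2 * xdot i j) *:
    (haug (fvec (y i)) *m (svec i)^T *m Psi i j *m ovec j).
Definition DOmega (i j : 'I_nI) : 'cV[R]_dim_v := 0.

Definition VPhi (i j : 'I_nI) : 'cV[R]_dim_v := CPhi i j + DPhi i j.
Definition VPsi (i j : 'I_nI) : 'cV[R]_dim_v := CPsi i j + DPsi i j.
Definition VOmega (i j : 'I_nI) : 'cV[R]_dim_v := COmega i j + DOmega i j.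

End AuxiliaryQuantities.

Definition tr_sq_hessian_loss (theta : 'cV[R]_dim_theta) : R :=
  \tr (hessian loss theta *m hessian loss theta).

End Network.

(* Main.v *)
Require Import Defs.
From mathcomp Require Import all_boot all_order all_algebra.
From mathcomp Require Import all_classical all_reals all_analysis.
From mathcomp Require Import ring lra.
Import GRing.Theory Num.Theory.
Import Order.TTheory.
Import numFieldNormedType.Exports.

(** Since the loss is a sum of cross entropies of sigmoids, its Hessian is
    [sum_i s'(z_i) g_i g_i^T + delta_i B_i], where [g_i] and [B_i] are the
    gradient and the Hessian of [z_i].  Write [A_i], [E], [e0] for the matrices
    whose rows are the values on the standard basis of the linear maps
    [theta |-> y_i], [theta |-> Vtilde^T] and [theta |-> c].  Then
      [g_i = e0 + E f_i + A_i F'_i Vtilde^T],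
      [B_i = A_i F'_i E^T + E F'_i A_i^T + A_i diag(Vtilde) F''_i A_i^T],
    and the relations [A_i^T A_j = (1 + x_i . x_j) 1], [E^T E = 1],
    [A_i^T E = 0] reduce the trace of the squared Hessian to a double sum of
    products of [s'(z_i)], [delta_i] and polynomials in [Vtilde].  The
    derivative in [v] of that sum, in which the [y_i] are constants, is taken
    term by term; exchanging [i] and [j] yields the factor 2. *)

Local Open Scope ring_scope.

Set Implicit Arguments.
Unset Strict Implicit.
Unset Printing Implicit Defensive.

(** * Directional derivatives as derivatives along lines *)

Section DirectionalDerivatives.
Variables (R : realType) (V : normedModType R).
Implicit Types (a d : V) (g : V -> R).

(** Both difference quotients are the same function of the increment, so one-variable results such
    as the chain rule carry over to directional derivatives. *)
Lemma is_derive_lineE a d g l :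
  is_derive a d g l <-> is_derive (0 : R) 1 (fun t : R => g (t *: d + a)) l.
Proof.
have e : (fun h : R => h^-1 *: ((g \o shift a) (h *: d) - g a)) =
   (fun h : R => h^-1 *: (((fun t : R => g (t *: d + a)) \o shift 0) (h *: 1)
                          - g (0 *: d + a))).
  by apply/funext => h /=; rewrite addr0 scaler1 scale0r add0r.
split=> -[D E]; split.
- by rewrite /derivable -e.
- by rewrite /derive -e.
- by rewrite /derivable e.
- by rewrite /derive e.
Qed.

Lemma is_derive_comp a d g (phi : R -> R) l m :
  is_derive (g a) 1 phi m -> is_derive a d g l ->
  is_derive a d (fun u => phi (g u)) (m * l).
Proof.
move=> hphi /is_derive_lineE hg; apply/is_derive_lineE.
apply: (@is_derive1_comp _ phi (fun t : R => g (t *: d + a))).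
by rewrite scale0r add0r.
Qed.

Lemma is_derive_mul a d g h l m :
  is_derive a d g l -> is_derive a d h m ->
  is_derive a d (fun u => g u * h u) (l * h a + g a * m).
Proof.
move=> hg hh; apply: (is_derive_eq (is_deriveM hg hh)).
by rewrite addrC; congr (_ + _); rewrite /GRing.scale /= mulrC.
Qed.

Lemma is_derive_add a d g h l m :
  is_derive a d g l -> is_derive a d h m ->
  is_derive a d (fun u => g u + h u) (l + m).
Proof. exact: is_deriveD. Qed.

Lemma is_derive_sub a d g h l m :
  is_derive a d g l -> is_derive a d h m ->
  is_derive a d (fun u => g u - h u) (l - m).
Proof. exact: is_deriveB. Qed.

Lemma is_derive_const a d (c : R) : is_derive a d (fun=> c) 0.
Proof. exact: is_derive_cst. Qed.

Lemma is_derive_mulc a d g l (c : R) :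
  is_derive a d g l -> is_derive a d (fun u => c * g u) (c * l).
Proof.
by move=> hg; have := is_derive_mul (is_derive_const a d c) hg; rewrite mul0r add0r.
Qed.

Lemma is_derive_bigsum a d n (g : 'I_n -> V -> R) (l : 'I_n -> R) :
  (forall i, is_derive a d (g i) (l i)) ->
  is_derive a d (fun u => \sum_(i < n) g i u) (\sum_(i < n) l i).
Proof.
by move=> hg; have := is_derive_sum hg; rewrite fct_sumE.
Qed.

End DirectionalDerivatives.

(** On the line through [a] in direction [d], a linear [g] is affine in [t] with slope [g d]. *)
Lemma is_derive_linear (R : realType) (V : normedModType R) (a d : V)
    (g : V -> R) : scalar g -> is_derive a d g (g d).
Proof.
move=> lin_g; apply/is_derive_lineE.
have -> : (fun t : R => g (t *: d + a)) = (fun t : R => g d * t + g a).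
  by apply/funext => t; rewrite lin_g mulrC.
have h := is_derive_add (is_derive_mulc (g d) (is_derive_id (0 : R) 1))
  (is_derive_const (0 : R) 1 (g a)).
by rewrite mulr1 addr0 in h.
Qed.

(** * The sigmoid, its derivatives and the cross entropy *)

Section Sigmoid.
Variable R : realType.
Implicit Type t : R.

Lemma sigmoid_gt0 t : 0 < sigmoid t.
Proof. by rewrite invr_gt0 ltr_wpDr ?expR_ge0. Qed.

Lemma sigmoid_lt1 t : sigmoid t < 1.
Proof. by rewrite invf_lt1 ?ltrDl ?expR_gt0 // ltr_wpDr ?expR_ge0. Qed.

Lemma is_derive_sigmoid t :
  is_derive t 1 (@sigmoid R) (sigmoid t * (1 - sigmoid t)).
Proof.
have e_gt0 := expR_gt0 (- t).
have nz : 1 + expR (- t) != 0 by rewrite gt_eqF // addr_gt0.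
have hN : is_derive t (1 : R) (fun u : R => - u) (- 1) by exact: is_deriveNid.
have he : is_derive t (1 : R) (fun u : R => expR (- u)) (expR (- t) * - 1).
  exact: is_derive_comp.
have h1 : is_derive t (1 : R) (fun u : R => 1 + expR (- u)) (0 + expR (- t) * - 1).
  by apply: is_derive_add.
apply: (is_derive_eq (is_deriveV (f := fun u : R => 1 + expR (- u)) nz h1)).
by rewrite /sigmoid /GRing.scale /=; field.
Qed.

Lemma derive1_sigmoid t : ((@sigmoid R)^`())%classic t = sigmoid t * (1 - sigmoid t).
Proof. by rewrite derive1E; have [_ ->] := is_derive_sigmoid t. Qed.

(** By s' = s (1 - s), s' is differentiable as a product; the value is kept as the symbol s''. *)
Lemma is_derive_sigmoid1 t :
  is_derive t 1 (@sigmoid R)^`()%classic (((@sigmoid R)^`(2))%classic t).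
Proof.
have e : ((@sigmoid R)^`())%classic = fun u => sigmoid u * (1 - sigmoid u).
  by apply/funext => u; exact: derive1_sigmoid.
have ds := is_derive_sigmoid t.
have h := is_derive_mul ds (is_derive_sub (is_derive_const t 1 1) ds).
rewrite -e in h.
apply: (is_derive_eq h).
by rewrite derive1nS derive1E; case: h => _; rewrite derive1n1 => ->.
Qed.

(** Since 0 < s < 1, both logarithms are differentiable, and s' = s (1 - s) cancels their
    denominators. Hence only the residuals p_i - q_i enter the gradient of the loss. *)
Lemma is_derive_cross_entropy (c t : R) :
  is_derive t 1 (fun u => c * ln (sigmoid u) + (1 - c) * ln (1 - sigmoid u))
    (c - sigmoid t).
Proof.
have s0 := sigmoid_gt0 t; have s1 := sigmoid_lt1 t.
have ds := is_derive_sigmoid t.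
have d1s := is_derive_sub (is_derive_const t 1 1) ds.
have l1 := is_derive_comp (is_derive1_ln s0) ds.
have s1' : 0 < 1 - sigmoid t by rewrite subr_gt0.
have l2 := is_derive_comp (g := fun u => 1 - sigmoid u) (is_derive1_ln s1') d1s.
apply: (is_derive_eq (is_derive_add (is_derive_mulc c l1) (is_derive_mulc (1 - c) l2))).
by field; rewrite !gt_eqF //; lra.
Qed.

End Sigmoid.

(** * First and second derivatives of the logits and of the loss in theta *)

Section LossHessian.
Variables (R : realType) (M N nI : nat).
Variables (f : R -> R) (f_diff : thrice_differentiable f).
Variables (x : 'I_nI -> 'cV[R]_M) (q : 'I_nI -> bool).
Local Notation param := 'cV[R]_((1 + M) * N + (1 + N)).
Implicit Types (theta d e : param) (i j : 'I_nI) (n : 'I_N).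

Lemma is_derive_iter k (t : R) : (k < 3)%N ->
  is_derive t 1 (f^`(k)%classic) ((f^`(k.+1)%classic) t).
Proof.
move=> k3; rewrite derive1nS derive1E.
exact/derivableP/f_diff.
Qed.

(** These three coordinates are linear in [theta], so their derivative in direction [d] is their
    value at [d]; all derivatives of z_i are expressed through such values. *)
Definition vbias theta : R := Vmx theta 0 (lshift N 0).
Definition vcoef theta n : R := Vtilde theta 0 n.
Definition ycoef theta i n : R := yvec x theta i n 0.

Lemma scalar_vbias : scalar vbias.
Proof. by move=> t u w; rewrite /vbias !mxE. Qed.

Lemma scalar_vcoef n : scalar (fun theta => vcoef theta n).
Proof. by move=> t u w; rewrite /vcoef !mxE. Qed.

Lemma scalar_ycoef i n : scalar (fun theta => ycoef theta i n).
Proof.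
move=> t u w; rewrite /ycoef /yvec !mxE mulr_sumr -big_split /=.
by apply: eq_bigr => k _; rewrite !mxE; ring.
Qed.

Lemma zvalE theta i : zval f x theta i =
  vbias theta + \sum_n vcoef theta n * f (ycoef theta i n).
Proof.
rewrite /zval /scalar_of mxE big_split_ord /= big_ord1 col_mxEu.
rewrite [1%:M _ _]mxE mulr1.
by congr (_ + _); apply: eq_bigr => n _;
  rewrite col_mxEd /vcoef [rsubmx _ _ _]mxE [fvec _ _ _ _]mxE.
Qed.

(** The derivative of z_i at [theta] in direction [d]; [d2z] differentiates it once more, in
    direction [e]. *)
Definition dz theta d i : R := vbias d +
  \sum_n (vcoef d n * f (ycoef theta i n)
          + vcoef theta n * ((f^`(1)%classic) (ycoef theta i n) * ycoef d i n)).

Definition d2z theta d e i : R :=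
  \sum_n (vcoef d n * ((f^`(1)%classic) (ycoef theta i n) * ycoef e i n)
    + (vcoef e n * ((f^`(1)%classic) (ycoef theta i n) * ycoef d i n)
       + vcoef theta n * ((f^`(2)%classic) (ycoef theta i n) * ycoef e i n * ycoef d i n))).

Lemma is_derive_iter_ycoef k theta e i n : (k < 3)%N ->
  is_derive theta e (fun u => (f^`(k)%classic) (ycoef u i n))
    ((f^`(k.+1)%classic) (ycoef theta i n) * ycoef e i n).
Proof.
move=> k3; apply: (is_derive_comp (g := fun u : param => ycoef u i n)).
  exact: is_derive_iter.
exact/is_derive_linear/scalar_ycoef.
Qed.

Lemma is_derive_zval theta d i :
  is_derive theta d (fun u => zval f x u i) (dz theta d i).
Proof.
rewrite (_ : (fun u => _) =
    fun u => vbias u + \sum_n vcoef u n * f (ycoef u i n)); last first.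
  by apply/funext => u; exact: zvalE.
apply: is_derive_add; first exact/is_derive_linear/scalar_vbias.
apply: is_derive_bigsum => n; apply: is_derive_mul.
  exact/is_derive_linear/scalar_vcoef.
exact: (@is_derive_iter_ycoef 0).
Qed.

Lemma is_derive_dz theta d e i :
  is_derive theta e (fun u => dz u d i) (d2z theta d e i).
Proof.
rewrite -[X in is_derive _ _ _ X]add0r.
apply: (is_derive_add (is_derive_const _ _ _)).
apply: is_derive_bigsum => n; apply: is_derive_add.
  by apply: is_derive_mulc; exact: (@is_derive_iter_ycoef 0).
apply: is_derive_mul; first exact/is_derive_linear/scalar_vcoef.
under eq_fun do rewrite mulrC.
rewrite mulrC; apply: is_derive_mulc.
exact: (@is_derive_iter_ycoef 1).
Qed.

Lemma is_derive_pval theta d i :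
  is_derive theta d (fun u => pval f x u i) (sig1 f x theta i * dz theta d i).
Proof.
apply: is_derive_comp; last exact: is_derive_zval.
rewrite /sig1 derive1_sigmoid; exact: is_derive_sigmoid.
Qed.

Lemma is_derive_loss theta d :
  is_derive theta d (loss f x q) (\sum_i delta f x q theta i * dz theta d i).
Proof.
have dce i := is_derive_comp (is_derive_cross_entropy (q i)%:R _)
  (is_derive_zval theta d i).
have h := is_derive_mulc (- 1) (is_derive_bigsum dce).
rewrite (_ : loss f x q = fun u => - 1 * \sum_i ((q i)%:R * ln (pval f x u i)
    + (1 - (q i)%:R) * ln (1 - pval f x u i))).
  apply: (is_derive_eq h); rewrite mulr_sumr; apply: eq_bigr => i _.
  by rewrite /delta /pval; ring.
by apply/funext => u; rewrite mulN1r.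
Qed.

(** The product rule on delta_i dz_i: the derivative of delta_i is s'(z_i) dz_i, since q_i is
    constant. Entry (k, l) differentiates along l first and k second, which fixes the argument order
    of [d2z]. *)
Lemma hessian_lossE theta k l : hessian (loss f x q) theta k l =
  \sum_i (sig1 f x theta i * dz theta (delta_mx k 0) i * dz theta (delta_mx l 0) i
          + delta f x q theta i * d2z theta (delta_mx l 0) (delta_mx k 0) i).
Proof.
rewrite mxE /partial.
rewrite (_ : (fun u => 'D__ _ u) =
    fun u => \sum_i delta f x q u i * dz u (delta_mx l 0) i); last first.
  by apply/funext => u; have [_ ->] := is_derive_loss u (delta_mx l 0).
have h : is_derive theta (delta_mx k 0 : param)
    (fun u => \sum_i delta f x q u i * dz u (delta_mx l 0) i)
  (\sum_i (sig1 f x theta i * dz theta (delta_mx k 0) i * dz theta (delta_mx l 0) i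
          + delta f x q theta i * d2z theta (delta_mx l 0) (delta_mx k 0) i)).
  apply: is_derive_bigsum => i; apply: is_derive_mul; last exact: is_derive_dz.
  rewrite -[X in is_derive _ _ _ X]subr0.
  exact: (is_derive_sub (is_derive_pval _ _ _) (is_derive_const _ _ _)).
by have [_ ->] := h.
Qed.

End LossHessian.

(** * The trace as a function of the output parameters, and its derivative *)

Section TraceDerivative.
Variables (R : realType) (N nI : nat) (y0 y1 y2 : 'I_nI -> 'I_N -> R).
Variables (X : 'I_nI -> 'I_nI -> R) (q : 'I_nI -> R).
Hypothesis XC : forall i j, X i j = X j i.
Implicit Types (v e : 'cV[R]_(1 + N)) (i j : 'I_nI).

Definition coef v n : R := v (rshift 1 n) 0.
Definition logit v i : R := v (lshift N 0) 0 + \sum_n coef v n * y0 i n.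
Definition slope v i : R := ((@sigmoid R)^`())%classic (logit v i).
Definition slope2 v i : R := ((@sigmoid R)^`(2))%classic (logit v i).
Definition resid v i : R := sigmoid (logit v i) - q i.
Definition hdot i j : R := 1 + \sum_n y0 i n * y0 j n.
(* [phi11h], [phi22] are polarised in the output weights: the paper's quantities
   are [phi11h v v] and [phi22 v v], and half their derivative in the direction
   [e] is obtained by replacing one of the two arguments by [e]. *)
Definition phi11h v e i j : R := \sum_n coef v n * coef e n * (y1 i n * y1 j n).
(** The (1,2) entry of Phi_ij, cubic in the output weights; exchanging [i] and [j] gives the (2,1)
    entry. *)
Definition phi12 v i j : R := \sum_n coef v n ^+ 3 * (y1 i n ^+ 2 * y2 j n).
Definition dphi12 v e i j : R :=
  \sum_n 3 * coef v n ^+ 2 * coef e n * (y1 i n ^+ 2 * y2 j n).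
Definition psi12 v i j : R := \sum_n coef v n * (y0 i n * y1 i n * y1 j n).
Definition phi22 v e i j : R := \sum_n coef v n * coef e n * (y2 i n * y2 j n).
Definition psi22 i j : R := \sum_n y1 i n * y1 j n.

(** The trace of the product of s'_i g_i g_i^T + delta_i B_i and s'_j g_j g_j^T + delta_j B_j, one
    line for each of the four products. The squared factor is g_i . g_j; its square expands into the
    Omega, Psi and Phi contributions with weight s'_i s'_j. *)
Definition trace_term v i j : R :=
  slope v i * slope v j *
    ((hdot i j + X i j * phi11h v v i j) * (hdot i j + X i j * phi11h v v i j))
  + slope v i * resid v j * (X i j ^+ 2 * phi12 v i j + 2 * X i j * psi12 v i j)
  + resid v i * slope v j * (X i j ^+ 2 * phi12 v j i + 2 * X i j * psi12 v j i)
  + resid v i * resid v j * (X i j ^+ 2 * phi22 v v i j + 2 * X i j * psi22 i j).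

(* The derivative of [trace_term v i j] in the direction [e] is
   [half_term v e i j + half_term v e j i]; for [e] the k-th basis vector,
   [half_term v e i j] is the k-th entry of the paper's summand (i, j). *)
Definition half_term v e i j : R :=
  X i j ^+ 2 *
    (2 * phi11h v v i j * phi11h v e i j * (slope v i * slope v j)
     + dphi12 v e i j * (slope v i * resid v j)
     + phi22 v e i j * (resid v i * resid v j))
  + X i j ^+ 2 * (logit e i *
    ((slope2 v i * phi11h v v i j ^+ 2 + slope v i * phi12 v j i) * slope v j
     + (slope2 v i * phi12 v i j + slope v i * phi22 v v i j) * resid v j))
  + (2 * X i j *
      (hdot i j * phi11h v e i j * (slope v i * slope v j)
       + psi12 e i j * (slope v i * resid v j))
    + 2 * X i j * (logit e i *
       ((slope2 v i * (hdot i j * phi11h v v i j) + slope v i * psi12 v j i) * slope v j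
        + (slope2 v i * psi12 v i j + slope v i * psi22 i j) * resid v j)))
  + slope2 v i * slope v j * hdot i j ^+ 2 * logit e i.

Lemma scalar_coef n : scalar (fun v => coef v n).
Proof. by move=> t u w; rewrite /coef !mxE. Qed.

Lemma scalar_psi12 i j : scalar (fun v => psi12 v i j).
Proof.
move=> t u w; rewrite /psi12 mulr_sumr -big_split /=.
by apply: eq_bigr => n _; rewrite scalar_coef; ring.
Qed.

Lemma scalar_logit i : scalar (fun v => logit v i).
Proof.
move=> t u w; rewrite /logit !mxE mulrDr mulr_sumr addrACA -big_split /=.
by congr (_ + _); apply: eq_bigr => n _; rewrite scalar_coef; ring.
Qed.

Lemma is_derive_slope v e i :
  is_derive v e (fun u => slope u i) (slope2 v i * logit e i).
Proof.
apply: (is_derive_comp (g := fun u => logit u i)); first exact: is_derive_sigmoid1.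
exact/is_derive_linear/scalar_logit.
Qed.

Lemma is_derive_resid v e i :
  is_derive v e (fun u => resid u i) (slope v i * logit e i).
Proof.
rewrite -[X in is_derive _ _ _ X]subr0.
apply: is_derive_sub; apply: (is_derive_comp (g := fun u => logit u i)).
  by rewrite /slope derive1_sigmoid; exact: is_derive_sigmoid.
exact/is_derive_linear/scalar_logit.
Qed.

Lemma is_derive_coef v e n : is_derive v e (fun u => coef u n) (coef e n).
Proof. exact/is_derive_linear/scalar_coef. Qed.

Lemma is_derive_sum_weighted v e (h : 'I_N -> 'cV[R]_(1 + N) -> R)
    (l w : 'I_N -> R) : (forall n, is_derive v e (h n) (l n)) ->
  is_derive v e (fun u => \sum_n h n u * w n) (\sum_n l n * w n).
Proof.
move=> dh; apply: is_derive_bigsum => n.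
under eq_fun do rewrite mulrC.
rewrite mulrC; exact: is_derive_mulc.
Qed.

Lemma is_derive_phi11h v e i j :
  is_derive v e (fun u => phi11h u u i j) (2 * phi11h v e i j).
Proof.
apply: (is_derive_eq (is_derive_sum_weighted _
  (fun n => is_derive_mul (is_derive_coef v e n) (is_derive_coef v e n)))).
by rewrite /phi11h mulr_sumr; apply: eq_bigr => n _; ring.
Qed.

Lemma is_derive_phi22 v e i j :
  is_derive v e (fun u => phi22 u u i j) (2 * phi22 v e i j).
Proof.
apply: (is_derive_eq (is_derive_sum_weighted _
  (fun n => is_derive_mul (is_derive_coef v e n) (is_derive_coef v e n)))).
by rewrite /phi22 mulr_sumr; apply: eq_bigr => n _; ring.
Qed.

Lemma is_derive_phi12 v e i j :
  is_derive v e (fun u => phi12 u i j) (dphi12 v e i j).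
Proof.
have dc n := is_derive_coef v e n.
apply: (is_derive_eq (is_derive_sum_weighted _
  (fun n => is_derive_mul (dc n) (is_derive_mul (dc n) (dc n))))).
by apply: eq_bigr => n _; ring.
Qed.

Lemma is_derive_psi12 v e i j : is_derive v e (fun u => psi12 u i j) (psi12 e i j).
Proof. exact/is_derive_linear/scalar_psi12. Qed.

Lemma hdotC i j : hdot i j = hdot j i.
Proof. by congr (_ + _); apply: eq_bigr => n _; rewrite mulrC. Qed.

Lemma phi11hC v e i j : phi11h v e i j = phi11h v e j i.
Proof. by apply: eq_bigr => n _; congr (_ * _); rewrite mulrC. Qed.

Lemma phi22C v e i j : phi22 v e i j = phi22 v e j i.
Proof. by apply: eq_bigr => n _; congr (_ * _); rewrite mulrC. Qed.

Lemma psi22C i j : psi22 i j = psi22 j i.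
Proof. by apply: eq_bigr => n _; rewrite mulrC. Qed.

Lemma is_derive_trace_term v e i j :
  is_derive v e (fun u => trace_term u i j) (half_term v e i j + half_term v e j i).
Proof.
have ds k := is_derive_slope v e k; have dr k := is_derive_resid v e k.
have droot := is_derive_add (is_derive_const v e (hdot i j))
  (is_derive_mulc (X i j) (is_derive_phi11h v e i j)).
have dphipsi12 k l := is_derive_add (is_derive_mulc (X i j ^+ 2) (is_derive_phi12 v e k l))
  (is_derive_mulc (2 * X i j) (is_derive_psi12 v e k l)).
have dphipsi22 := is_derive_add (is_derive_mulc (X i j ^+ 2) (is_derive_phi22 v e i j))
  (is_derive_const v e (2 * X i j * psi22 i j)).
apply: (is_derive_eq (is_derive_add (is_derive_add (is_derive_add
  (is_derive_mul (is_derive_mul (ds i) (ds j)) (is_derive_mul droot droot))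
  (is_derive_mul (is_derive_mul (ds i) (dr j)) (dphipsi12 i j)))
  (is_derive_mul (is_derive_mul (dr i) (ds j)) (dphipsi12 j i)))
  (is_derive_mul (is_derive_mul (dr i) (dr j)) dphipsi22))).
(* Quantities symmetric in the two indices are oriented to (i, j); [phi12], [dphi12] and [psi12]
   remain in both orders as distinct atoms. *)
rewrite /half_term (XC j i) (hdotC j i) (psi22C j i).
rewrite (phi11hC v v j i) (phi11hC v e j i) (phi22C v v j i) (phi22C v e j i).
move: (phi12 v i j) (phi12 v j i) (dphi12 v e i j) (dphi12 v e j i) (psi12 v i j) (psi12 v j i)
  (psi12 e i j) (psi12 e j i) (phi11h v v i j) (phi11h v e i j) (phi22 v v i j) (phi22 v e i j).
move: (X i j) (hdot i j) (psi22 i j) (slope v i) (slope v j) (slope2 v i) (slope2 v j)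
  (resid v i) (resid v j) (logit e i) (logit e j) => *; ring.
Qed.

Lemma is_derive_trace v e :
  is_derive v e (fun u => \sum_i \sum_j trace_term u i j)
    (2 * \sum_i \sum_j half_term v e i j).
Proof.
apply: (is_derive_eq (is_derive_bigsum (fun i =>
  is_derive_bigsum (fun j => is_derive_trace_term v e i j)))).
under eq_bigr do rewrite big_split /=.
by rewrite big_split /= [X in _ + X]exchange_big mulr_natl mulr2n.
Qed.

End TraceDerivative.

(** * Parameter directions and their orthogonality relations *)

Section HessianTrace.
Variables (R : realType) (M N nI : nat).
Variables (f : R -> R) (x : 'I_nI -> 'cV[R]_M).
Local Notation dim_theta := ((1 + M) * N + (1 + N))%N.
Local Notation param := 'cV[R]_dim_theta.
Implicit Types (theta d e : param) (i j : 'I_nI) (n : 'I_N).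

(** Enumerating the transpose of W row by row stacks the columns of W: [m] is a column of W and [n]
    a hidden unit. *)
Definition windex (m : 'I_(1 + M)) n : 'I_dim_theta := lshift _ (mxvec_index m n).
Definition vindex (p : 'I_(1 + N)) : 'I_dim_theta := rshift _ p.

Lemma sum_param (F : 'I_dim_theta -> R) : \sum_k F k =
  \sum_m \sum_n F (windex m n)
  + (F (vindex (lshift N 0)) + \sum_n F (vindex (rshift 1 n))).
Proof.
rewrite big_split_ord /=; congr (_ + _); last by rewrite big_split_ord /= big_ord1.
rewrite pair_big /= (reindex (uncurry (@mxvec_index (1 + M) N))) /=.
  by apply: eq_bigr => -[].
exact: curry_mxvec_bij.
Qed.

Lemma windex_eq m n m' n' :
  (windex m n == windex m' n') = (m == m') && (n == n').
Proof.
by rewrite eq_lshift (inj_eq (@cast_ord_inj _ _ _)) (inj_eq enum_rank_inj).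
Qed.

Lemma vbias_windex m n : vbias (delta_mx (windex m n) 0 : param) = 0.
Proof. by rewrite /vbias !mxE eq_rlshift. Qed.

Lemma vbias_vindex p : vbias (delta_mx (vindex p) 0 : param) = (lshift N 0 == p)%:R.
Proof. by rewrite /vbias !mxE eq_rshift eqxx andbT. Qed.

Lemma vcoef_windex m n n' : vcoef (delta_mx (windex m n) 0 : param) n' = 0.
Proof. by rewrite /vcoef !mxE eq_rlshift. Qed.

Lemma vcoef_vindex p n :
  vcoef (delta_mx (vindex p) 0 : param) n = (rshift 1 n == p)%:R.
Proof. by rewrite /vcoef !mxE eq_rshift eqxx andbT. Qed.

Lemma ycoef_windex i m n n' : ycoef x (delta_mx (windex m n) 0) i n' =
  (n' == n)%:R * haug (x i) m 0.
Proof.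
rewrite /ycoef mxE (bigD1 m) //= big1 => [|m' /negPf m'm]; last first.
  by rewrite !mxE windex_eq m'm mul0r.
by rewrite addr0 !mxE windex_eq !eqxx andbT.
Qed.

Lemma ycoef_vindex i p n : ycoef x (delta_mx (vindex p) 0) i n = 0.
Proof.
rewrite /ycoef mxE big1 // => m _.
by rewrite !mxE eq_lrshift mul0r.
Qed.

(** [dirbias], [dircoef] and [diry i] are the matrices e0, E and A_i. *)
Definition dirbias : 'cV[R]_dim_theta := \col_k vbias (delta_mx k 0 : param).
Definition dircoef : 'M[R]_(dim_theta, N) :=
  \matrix_(k, n) vcoef (delta_mx k 0 : param) n.
Definition diry i : 'M[R]_(dim_theta, N) :=
  \matrix_(k, n) ycoef x (delta_mx k 0) i n.

Lemma haug_dot (x1 x2 : 'cV[R]_M) :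
  \sum_m haug x1 m 0 * haug x2 m 0 = 1 + scalar_of (x1^T *m x2).
Proof.
rewrite big_split_ord /= big_ord1 !col_mxEu !mxE mul1r; congr (_ + _).
by rewrite /scalar_of mxE; apply: eq_bigr => m _; rewrite !col_mxEd mxE.
Qed.

(** e0, E and A_i are supported on the rows of c, of Vtilde and of W respectively. These row sets
    are disjoint, so the mixed products below vanish. *)
Lemma dirbiasTbias : dirbias^T *m dirbias = 1%:M.
Proof.
apply/matrixP => a b; rewrite !ord1 !mxE sum_param !mxE.
rewrite !vbias_vindex eqxx mulr1 big1 ?add0r => [|m _]; last first.
  by apply: big1 => n _; rewrite !mxE vbias_windex mul0r.
by rewrite big1 ?addr0 // => n _; rewrite !mxE vbias_vindex eq_lrshift mul0r.
Qed.

Lemma dirbiasTcoef : dirbias^T *m dircoef = 0.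
Proof.
apply/matrixP => a n; rewrite !mxE sum_param !mxE.
rewrite vcoef_vindex eq_rlshift mulr0 big1 ?add0r => [|m _]; last first.
  by apply: big1 => n' _; rewrite !mxE vbias_windex mul0r.
by apply: big1 => n' _; rewrite !mxE vbias_vindex eq_lrshift mul0r.
Qed.

Lemma dircoefTcoef : dircoef^T *m dircoef = 1%:M.
Proof.
apply/matrixP => a b; rewrite !mxE sum_param !mxE.
rewrite vcoef_vindex eq_rlshift mul0r big1 ?add0r => [|m _]; last first.
  by apply: big1 => n _; rewrite !mxE vcoef_windex mul0r.
rewrite (bigD1 a) //= big1 => [|n /negPf na]; last first.
  by rewrite !mxE !vcoef_vindex !eq_rshift eq_sym na mul0r.
by rewrite !mxE !vcoef_vindex !eq_rshift eqxx mul1r addr0 eq_sym.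
Qed.

Lemma diryTbias i : (diry i)^T *m dirbias = 0.
Proof.
apply/matrixP => a b; rewrite !mxE sum_param !mxE.
rewrite ycoef_vindex mul0r add0r big1 ?add0r => [|m _]; last first.
  by apply: big1 => n' _; rewrite !mxE vbias_windex mulr0.
by apply: big1 => n' _; rewrite !mxE ycoef_vindex mul0r.
Qed.

Lemma diryTcoef i : (diry i)^T *m dircoef = 0.
Proof.
apply/matrixP => a b; rewrite !mxE sum_param !mxE.
rewrite ycoef_vindex mul0r add0r big1 ?add0r => [|m _]; last first.
  by apply: big1 => n' _; rewrite !mxE vcoef_windex mulr0.
by apply: big1 => n' _; rewrite !mxE ycoef_vindex mul0r.
Qed.

(** The row of A_i at the weight (m, n) is the n-th basis row scaled by entry m of h(x_i), so the
    product collapses to h(x_i) . h(x_j) times the identity. *)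
Lemma diryTy i j : (diry i)^T *m diry j = (xdot x i j)%:M.
Proof.
apply/matrixP => a b; rewrite !mxE sum_param !mxE.
rewrite !ycoef_vindex mul0r add0r [X in _ + X]big1 ?addr0 => [|n _]; last first.
  by rewrite !mxE !ycoef_vindex mul0r.
rewrite /xdot -haug_dot -sumrMnl; apply: eq_bigr => m _.
move: (haug (x i)) (haug (x j)) (ycoef_windex i m) (ycoef_windex j m) => u v yi yj.
rewrite (bigD1 a) //= big1 => [|n /negPf na]; last first.
  by rewrite !mxE yi eq_sym na !mul0r.
rewrite !mxE yi yj eqxx mul1r addr0 [b == a]eq_sym.
by case: (a == b); rewrite ?mul1r ?mul0r ?mulr0.
Qed.

Lemma scalar_diag (u w d : 'cV[R]_N) :
  (u^T *m diagc d *m w) 0 0 = \sum_n u n 0 * d n 0 * w n 0.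
Proof. by rewrite mul_mx_diag mxE; apply: eq_bigr => n _; rewrite !mxE. Qed.

Lemma tr_diagc (u w : 'I_N -> R) :
  \tr (diagc (\col_n u n) *m diagc (\col_n w n)) = \sum_n u n * w n.
Proof.
by rewrite mul_mx_diag; apply: eq_bigr => n _; rewrite !mxE eqxx.
Qed.

Lemma vcoefE theta n : vcoef theta n = coef (vpart theta) n.
Proof. by rewrite /vcoef /coef !mxE. Qed.

(** * Gradient and Hessian of z_i in matrix form, and their traces *)

Section Fixed.
Variable theta : param.
Local Notation y := (yvec x theta).
Local Notation Vt := (Vtilde theta).
Local Notation v := (vpart theta).

Local Notation c n := (vcoef theta n).
Local Notation y0 := (fun i n => f (ycoef x theta i n)).
Local Notation y1 := (fun i n => (f^`())%classic (ycoef x theta i n)).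
Local Notation y2 := (fun i n => (f^`(2))%classic (ycoef x theta i n)).
Local Notation f0 i n := (f (ycoef x theta i n)).
Local Notation f1 i n := (f^`() (ycoef x theta i n))%classic.
Local Notation f2 i n := (f^`(2) (ycoef x theta i n))%classic.

Definition gradz i : 'cV[R]_dim_theta := \col_k dz f x theta (delta_mx k 0) i.
Definition hessz i : 'M[R]_dim_theta :=
  \matrix_(k, l) d2z f x theta (delta_mx l 0) (delta_mx k 0) i.
Definition curv i : 'M[R]_N := diagc Vt^T *m F2 f (y i).

Lemma gradzE i : gradz i =
  dirbias + dircoef *m fvec f (y i) + diry i *m (F1 f (y i) *m Vt^T).
Proof.
apply/matrixP => k a; rewrite !ord1 /F1 /diagc mul_diag_mx !mxE /dz.
rewrite -addrA -big_split /=; congr (_ + _); apply: eq_bigr => n _.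
by rewrite !mxE /vcoef /ycoef /F1 !mxE; ring.
Qed.

Lemma F1E i : F1 f (y i) = diagc (\col_n f1 i n).
Proof. by congr diagc; apply/matrixP => a b; rewrite !ord1 [LHS]mxE [RHS]mxE. Qed.

Lemma fvecE i : fvec f (y i) = \col_n f0 i n.
Proof. by apply/matrixP => a b; rewrite !ord1 [LHS]mxE [RHS]mxE. Qed.

Lemma fdot_hdot i j : fdot f x theta i j = hdot y0 i j.
Proof.
rewrite /fdot /scalar_of mxE; congr (_ + _); apply: eq_bigr => n _.
by rewrite !fvecE !mxE.
Qed.

Lemma F1VtE i : F1 f (y i) *m Vt^T = \col_n (f1 i n * c n).
Proof.
rewrite F1E mul_diag_mx; apply/matrixP => a b.
by rewrite !ord1 /vcoef !mxE.
Qed.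

Lemma curvE i : curv i = diagc (\col_n (c n * f2 i n)).
Proof.
rewrite /curv /F2 /diagc mulmx_diag; congr diag_mx.
by apply/matrixP => a b; rewrite !ord1 !mxE /vcoef /ycoef !mxE.
Qed.

Lemma hesszE i : hessz i =
  diry i *m F1 f (y i) *m dircoef^T + dircoef *m F1 f (y i) *m (diry i)^T
  + diry i *m curv i *m (diry i)^T.
Proof.
have E (A B : 'M[R]_(dim_theta, N)) (u : 'cV[R]_N) k l :
    (A *m diagc u *m B^T) k l = \sum_n A k n * u n 0 * B l n.
  by rewrite mul_mx_diag mxE; apply: eq_bigr => n _; rewrite !mxE.
apply/matrixP => k l; rewrite curvE F1E [RHS]mxE [X in _ = X + _]mxE !E mxE /d2z.
rewrite -!big_split /=; apply: eq_bigr => n _.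
by rewrite !mxE; ring.
Qed.

Lemma xdotC i j : xdot x i j = xdot x j i.
Proof.
rewrite /xdot /scalar_of; congr (_ + _); rewrite !mxE.
by apply: eq_bigr => m _; rewrite !mxE mulrC.
Qed.

Lemma dirbiasTgradz i : dirbias^T *m gradz i = 1%:M.
Proof.
have bTy : dirbias^T *m diry i = 0 by rewrite -[LHS]trmxK trmx_mul trmxK diryTbias trmx0.
by rewrite gradzE !mulmxDr !mulmxA dirbiasTbias dirbiasTcoef bTy !mul0mx !addr0.
Qed.

Lemma dircoefTgradz i : dircoef^T *m gradz i = fvec f (y i).
Proof.
have cTb : dircoef^T *m dirbias = 0.
  by rewrite -[LHS]trmxK trmx_mul trmxK dirbiasTcoef trmx0.
have cTy : dircoef^T *m diry i = 0 by rewrite -[LHS]trmxK trmx_mul trmxK diryTcoef trmx0.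
by rewrite gradzE !mulmxDr !mulmxA dircoefTcoef cTb cTy mul1mx !mul0mx addr0 add0r.
Qed.

Lemma diryTgradz i j :
  (diry i)^T *m gradz j = xdot x i j *: (F1 f (y j) *m Vt^T).
Proof.
rewrite gradzE !mulmxDr !(mulmxA (diry i)^T) diryTbias diryTcoef diryTy !mul0mx.
by rewrite !add0r mul_scalar_mx.
Qed.

(** By orthogonality only matching blocks meet: e0 gives 1 and E gives f_i . f_j, together [hdot],
    while the A blocks give the remaining term. *)
Lemma gradz_dot i j : scalar_of ((gradz i)^T *m gradz j) =
  hdot y0 i j + xdot x i j * phi11h y1 v v i j.
Proof.
rewrite {1}gradzE !linearD /= !mulmxDl trmx_mul -mulmxA dircoefTgradz dirbiasTgradz.
rewrite trmx_mul -(mulmxA _ (diry i)^T) diryTgradz -scalemxAr.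
rewrite -fdot_hdot /scalar_of [LHS]mxE [X in X + _]mxE [X in X + _ + _]mxE [X in _ + X]mxE.
congr (_ + _ * _); rewrite !F1VtE mxE.
by apply: eq_bigr => n _; rewrite !mxE vcoefE; ring.
Qed.

(** The two mixed blocks of B_j are transposes of each other and give equal scalars, hence the 2.
    The curvature block meets A_j^T g_i on both sides, hence the square of [xdot]. *)
Lemma gradz_hessz i j : scalar_of ((gradz i)^T *m hessz j *m gradz i) =
  xdot x i j ^+ 2 * phi12 y1 y2 v i j + 2 * xdot x i j * psi12 y0 y1 v i j.
Proof.
have E k (A B : 'M[R]_(dim_theta, k)) (D : 'M[R]_k) :
    (gradz i)^T *m (A *m D *m B^T) *m gradz i
    = (A^T *m gradz i)^T *m D *m (B^T *m gradz i).
  by rewrite trmx_mul trmxK !mulmxA.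
rewrite hesszE !mulmxDr !mulmxDl !E diryTgradz dircoefTgradz xdotC.
rewrite fvecE F1VtE F1E curvE.
rewrite /scalar_of [LHS]mxE [X in X + _]mxE !scalar_diag /phi12 /psi12.
rewrite !mulr_sumr -!big_split /=; apply: eq_bigr => n _.
by rewrite !mxE vcoefE; ring.
Qed.

(** Each mixed block of B_i pairs with one mixed block of B_j, giving twice [psi22]; the curvature
    blocks pair only with each other. *)
Lemma tr_hessz_mul i j : \tr (hessz i *m hessz j) =
  xdot x i j ^+ 2 * phi22 y2 v v i j + 2 * xdot x i j * psi22 y1 i j.
Proof.
have cTy k : dircoef^T *m diry k = 0.
  by rewrite -[LHS]trmxK trmx_mul trmxK diryTcoef trmx0.
have By : hessz i *m diry j = xdot x i j *: (dircoef *m F1 f (y i) + diry i *m curv i).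
  rewrite hesszE !mulmxDl -!(mulmxA _ _ (diry j)) cTy diryTy mulmx0 add0r.
  by rewrite !mul_mx_scalar scalerDr.
have Bc : hessz i *m dircoef = diry i *m F1 f (y i).
  rewrite hesszE !mulmxDl -!(mulmxA _ _ dircoef) dircoefTcoef diryTcoef.
  by rewrite mulmx1 !mulmx0 !addr0.
rewrite [hessz j]hesszE; move: (curv j) (curvE j) => Sj ESj.
move: (curv i) (curvE i) By => Si ESi By.
rewrite !mulmxDr !mxtraceD !mulmxA Bc By.
have cX : dircoef^T *m (dircoef *m F1 f (y i) + diry i *m Si) = F1 f (y i).
  by rewrite mulmxDr !(mulmxA dircoef^T) dircoefTcoef cTy mul1mx mul0mx addr0.
have yX : (diry j)^T *m (dircoef *m F1 f (y i) + diry i *m Si)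
    = xdot x i j *: Si.
  rewrite mulmxDr !(mulmxA (diry j)^T) diryTcoef diryTy mul0mx add0r.
  by rewrite mul_scalar_mx xdotC.
(* Cyclicity brings each trailing transposed factor to the front, where the orthogonality relations
   apply. *)
rewrite ![\tr (_ *m _^T)]mxtrace_mulC -!scalemxAl -!scalemxAr.
rewrite !mulmxA cX yX.
rewrite diryTy -xdotC mul_scalar_mx -!scalemxAl !mxtraceZ ESi ESj !F1E !tr_diagc.
have -> : phi22 y2 v v i j = \sum_n c n * f2 i n * (c n * f2 j n).
  by apply: eq_bigr => n _; rewrite mulrACA vcoefE.
rewrite /psi22; ring.
Qed.

End Fixed.
End HessianTrace.

(** * Two-by-two forms, Kronecker products and rank-one traces *)

Section SmallMatrices.
Variable R : realType.

Lemma vec2E (a b : R) (i : 'I_2) (j : 'I_1) :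
  vec2 a b i j = if i == 0 :> nat then a else b.
Proof.
by rewrite /vec2 mxE; case: (@splitP 1 1 i) => k ->; rewrite !ord1 mxE eqxx mulr1n.
Qed.

Lemma cols4_tens m (a b c d : 'cV[R]_m) (s t s' t' : R) k :
  (cols4 a b c d *m (vec2 s t *t vec2 s' t' : 'cV[R]_4)) k 0 =
  a k 0 * (s * s') + b k 0 * (s * t') + c k 0 * (t * s') + d k 0 * (t * t').
Proof.
(* The quotient of the position by 2 indexes the left factor, the remainder the right one. *)
have tensE (i : 'I_4) : (vec2 s t *t vec2 s' t' : 'cV[R]_4) i 0 =
    (if (i %/ 2 == 0)%N then s else t) * (if (i %% 2 == 0)%N then s' else t').
  by rewrite [LHS]mxE !vec2E.
rewrite mxE (@big_split_ord _ _ _ 1 3) /= big_ord1.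
rewrite (@big_split_ord _ _ _ 1 2) /= big_ord1.
rewrite (@big_split_ord _ _ _ 1 1) /= !big_ord1 !addrA !tensE /=.
rewrite /cols4 (@row_mxEl _ m 1 3) !(@row_mxEr _ m 1 3) (@row_mxEl _ m 1 2).
by rewrite !(@row_mxEr _ m 1 2) (@row_mxEl _ m 1 1) (@row_mxEr _ m 1 1).
Qed.

Lemma mx22_form (s t a b c d s' t' : R) :
  (vec2 s t)^T *m mx22 a b c d *m vec2 s' t' =
  ((s * a + t * c) * s' + (s * b + t * d) * t')%:M.
Proof.
rewrite /vec2 /mx22 (@tr_col_mx _ 1 1 1) (@mul_row_block _ 1 1 1 1 1).
rewrite (@mul_row_col _ 1 1 1 1) !tr_scalar_mx.
by rewrite -!scalar_mxM -!raddfD /= -!scalar_mxM -raddfD.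
Qed.

(** Cyclicity of the trace turns each product with a rank-one factor into a scalar form. *)
Lemma mxtrace_rank_one n (g h : 'cV[R]_n) (B C : 'M[R]_n) (a b c d : R) :
  \tr ((a *: (g *m g^T) + b *: B) *m (c *: (h *m h^T) + d *: C)) =
  a * c * (scalar_of (g^T *m h) * scalar_of (g^T *m h))
  + a * d * scalar_of (g^T *m C *m g) + b * c * scalar_of (h^T *m B *m h)
  + b * d * \tr (B *m C).
Proof.
have tr1 (A : 'M[R]_1) : \tr A = scalar_of A by rewrite /mxtrace big_ord1.
have hg : scalar_of (h^T *m g) = scalar_of (g^T *m h).
  by rewrite -[g^T *m h]trmxK trmx_mul trmxK /scalar_of [RHS]mxE.
rewrite mulmxDl !mulmxDr -!scalemxAl -!scalemxAr !mxtraceD !mxtraceZ.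
have -> : \tr (g *m g^T *m (h *m h^T)) = scalar_of (g^T *m h) * scalar_of (g^T *m h).
  rewrite -mulmxA mxtrace_mulC tr1 !mulmxA -(mulmxA (g^T *m h)).
  by rewrite -{2}hg /scalar_of mxE big_ord1.
have -> : \tr (g *m g^T *m C) = scalar_of (g^T *m C *m g).
  by rewrite -mulmxA mxtrace_mulC tr1.
have -> : \tr (B *m (h *m h^T)) = scalar_of (h^T *m B *m h).
  by rewrite mulmxA mxtrace_mulC tr1 mulmxA.
ring.
Qed.

End SmallMatrices.

(** * The trace of the squared loss Hessian as a double sum *)

Section TraceFormula.
Variables (R : realType) (M N nI : nat).
Variables (f : R -> R) (f_diff : thrice_differentiable f).
Variables (x : 'I_nI -> 'cV[R]_M) (q : 'I_nI -> bool).
Local Notation param := 'cV[R]_((1 + M) * N + (1 + N)).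
Implicit Types (theta d e : param) (i j : 'I_nI) (n : 'I_N).

Local Notation y0 theta := (fun i n => f (ycoef x theta i n)).
Local Notation y1 theta := (fun i n => (f^`())%classic (ycoef x theta i n)).
Local Notation y2 theta := (fun i n => (f^`(2))%classic (ycoef x theta i n)).
Local Notation q01 := (fun i => (q i)%:R : R).

Lemma zval_logit theta i : zval f x theta i = logit (y0 theta) (vpart theta) i.
Proof.
rewrite zvalE /logit; congr (_ + _); first by rewrite /vbias mxE.
by apply: eq_bigr => n _; rewrite vcoefE.
Qed.

Lemma sig1_slope theta i : sig1 f x theta i = slope (y0 theta) (vpart theta) i.
Proof. by rewrite /sig1 zval_logit. Qed.

Lemma sig2_slope2 theta i : sig2 f x theta i = slope2 (y0 theta) (vpart theta) i.
Proof. by rewrite /sig2 zval_logit. Qed.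

Lemma delta_resid theta i :
  delta f x q theta i = resid (y0 theta) q01 (vpart theta) i.
Proof. by rewrite /delta /pval zval_logit. Qed.

Lemma tr_sq_hessian_lossE theta : tr_sq_hessian_loss f x q theta =
  \sum_i \sum_j trace_term (y0 theta) (y1 theta) (y2 theta) (xdot x) q01
                  (vpart theta) i j.
Proof.
(* The entrywise Hessian is first read as a matrix sum; bilinearity then splits the trace over pairs
   (i, j). *)
have -> : tr_sq_hessian_loss f x q theta =
    \tr ((\sum_i (sig1 f x theta i *: (gradz f x theta i *m (gradz f x theta i)^T)
                 + delta f x q theta i *: hessz f x theta i))
      *m (\sum_i (sig1 f x theta i *: (gradz f x theta i *m (gradz f x theta i)^T)
                 + delta f x q theta i *: hessz f x theta i))).
  rewrite /tr_sq_hessian_loss; congr (\tr (_ *m _)).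
    apply/matrixP => k l; rewrite hessian_lossE // summxE.
    by apply: eq_bigr => i _; rewrite !mxE big_ord1 !mxE mulrA.
  apply/matrixP => k l; rewrite hessian_lossE // summxE.
  by apply: eq_bigr => i _; rewrite !mxE big_ord1 !mxE mulrA.
rewrite mulmx_suml raddf_sum; apply: eq_bigr => i _.
rewrite mulmx_sumr raddf_sum; apply: eq_bigr => j _.
rewrite -[LHS]/(\tr _) mxtrace_rank_one gradz_dot !gradz_hessz tr_hessz_mul.
rewrite /trace_term !sig1_slope !delta_resid (xdotC x j i).
by [].
Qed.

End TraceFormula.

(** * Diagonal forms and padded vectors as coordinate sums *)

Section DiagonalForms.
Variables (R : realType) (N : nat).
Implicit Types (r a b c d s : 'I_N -> R).

Lemma diag2_form r a b s :
  scalar_of ((\row_n r n) *m diagc (\col_n a n) *m diagc (\col_n b n) *m \col_n s n)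
  = \sum_n r n * a n * b n * s n.
Proof.
rewrite /scalar_of /diagc !mul_mx_diag mxE.
by apply: eq_bigr => n _; rewrite !mxE.
Qed.

Lemma diag4_form r a b c d s :
  scalar_of ((\row_n r n) *m diagc (\col_n a n) *m diagc (\col_n b n)
             *m diagc (\col_n c n) *m diagc (\col_n d n) *m \col_n s n)
  = \sum_n r n * a n * b n * c n * d n * s n.
Proof.
rewrite /scalar_of /diagc !mul_mx_diag mxE.
by apply: eq_bigr => n _; rewrite !mxE.
Qed.

Lemma dot_form r s :
  scalar_of ((\row_n r n) *m \col_n s n) = \sum_n r n * s n.
Proof. by rewrite /scalar_of mxE; apply: eq_bigr => n _; rewrite !mxE. Qed.

Lemma tr_col a : (\col_n a n)^T = \row_n a n.
Proof. by apply/matrixP => b n; rewrite !mxE. Qed.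

(** A basis direction selects one hidden unit, or none when it is the direction of c; this is the
    origin of the prepended zeros in f'_0, f''_0 and F'_0. *)
Lemma sum_coef_delta (k : 'I_(1 + N)) a :
  \sum_n coef (delta_mx k 0 : 'cV[R]_(1 + N)) n * a n
  = (col_mx 0 (\col_n a n) : 'cV[R]_(1 + N)) k 0.
Proof.
case: (split_ordP k) => l ->.
  rewrite col_mxEu mxE big1 // => n _.
  by rewrite /coef mxE eq_rlshift mul0r.
rewrite col_mxEd mxE (bigD1 l) //= big1 => [|n /negPf nl].
  by rewrite /coef mxE !eqxx mul1r addr0.
by rewrite /coef mxE eq_rshift nl mul0r.
Qed.

Lemma hadamardE m n (A B : 'M[R]_(m, n)) i j : (A *h B) i j = A i j * B i j.
Proof. by rewrite mxE. Qed.

Lemma hadamard_expE m n (A : 'M[R]_(m, n)) l i j :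
  hadamard_exp A l i j = A i j ^+ l.
Proof. by rewrite mxE. Qed.

Lemma padded_diag_form a b s (k : 'I_(1 + N)) :
  (col_mx (0 : 'M[R]_(1, N)) (diagc (\col_n a n)) *m diagc (\col_n b n) *m \col_n s n) k 0
  = \sum_n coef (delta_mx k 0 : 'cV[R]_(1 + N)) n * (a n * b n * s n).
Proof.
rewrite sum_coef_delta !mul_col_mx !mul0mx.
case: (split_ordP k) => l ->; first by rewrite !col_mxEu !mxE.
by rewrite !col_mxEd /diagc -mulmxA !mul_diag_mx !mxE mulrA.
Qed.

Lemma hadamard_form (u : 'cV[R]_(1 + N)) a b k :
  (u *h col_mx 0 (\col_n a n) *h col_mx 0 (\col_n b n)) k 0 =
  \sum_n coef (delta_mx k 0 : 'cV[R]_(1 + N)) n * (coef u n * (a n * b n)).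
Proof.
rewrite sum_coef_delta !hadamardE.
case: (split_ordP k) => l ->; first by rewrite !col_mxEu !mxE mulr0.
by rewrite !col_mxEd !mxE mulrA.
Qed.

Lemma hadamard_sq_form (u : 'rV[R]_(1 + N)) a b k :
  ((hadamard_exp u 2)^T *h hadamard_exp (col_mx 0 (\col_n a n)) 2
   *h col_mx 0 (\col_n b n)) k 0 =
  \sum_n coef (delta_mx k 0 : 'cV[R]_(1 + N)) n
          * (coef u^T n ^+ 2 * (a n ^+ 2 * b n)).
Proof.
rewrite sum_coef_delta !hadamardE [X in X * _ * _]mxE !hadamard_expE.
case: (split_ordP k) => l ->; first by rewrite !col_mxEu !mxE mulr0.
by rewrite !col_mxEd /coef !mxE mulrA.
Qed.

End DiagonalForms.

(** * Entries of the summands of the gradient *)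

Section GradientEntries.
Variables (R : realType) (M N nI : nat) (f : R -> R).
Variables (x : 'I_nI -> 'cV[R]_M) (q : 'I_nI -> bool).
Variable theta : 'cV[R]_((1 + M) * N + (1 + N)).
Local Notation y0 := (fun i n => f (ycoef x theta i n)).
Local Notation y1 := (fun i n => (f^`())%classic (ycoef x theta i n)).
Local Notation y2 := (fun i n => (f^`(2))%classic (ycoef x theta i n)).
Local Notation q01 := (fun i => (q i)%:R : R).
Local Notation v := (vpart theta).
Local Notation Vt := (Vtilde theta).
Local Notation y := (yvec x theta).
Local Notation e k := (delta_mx k 0 : 'cV[R]_(1 + N)).
Implicit Types (i j : 'I_nI) (k : 'I_(1 + N)) (n : 'I_N).

Lemma f1vecE i : f1vec f (y i) = \col_n y1 i n.
Proof. by apply/matrixP => a b; rewrite !ord1 [LHS]mxE [RHS]mxE. Qed.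

Lemma f2vecE i : f2vec f (y i) = \col_n y2 i n.
Proof. by apply/matrixP => a b; rewrite !ord1 [LHS]mxE [RHS]mxE. Qed.

Lemma VtE : Vt = \row_n coef v n.
Proof. by apply/matrixP => a n; rewrite ord1 [RHS]mxE -vcoefE. Qed.

Lemma VtTE : Vt^T = \col_n coef v n.
Proof. by apply/matrixP => n a; rewrite ord1 [RHS]mxE mxE -vcoefE. Qed.

(** With y_i frozen, z_i is linear in v with coefficient vector h(f(y_i)). *)
Lemma haug_logit i k : haug (fvec f (y i)) k 0 = logit y0 (e k) i.
Proof.
rewrite /logit sum_coef_delta fvecE; case: (split_ordP k) => l ->.
  by rewrite !col_mxEu !ord1 !mxE !eqxx addr0.
by rewrite !col_mxEd [delta_mx _ _ _ _]mxE eq_lrshift add0r.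
Qed.

Lemma Phi11_halfE i j : Phi11_half f x theta i j = phi11h y1 v v i j.
Proof.
rewrite /Phi11_half !F1E VtTE VtE diag2_form; apply: eq_bigr => n _.
by move: (coef v n) (y1 i n) (y1 j n) => *; ring.
Qed.

Lemma PhiE i j : Phi f x theta i j =
  mx22 (phi11h y1 v v i j ^+ 2) (phi12 y1 y2 v i j) (phi12 y1 y2 v j i) (phi22 y2 v v i j).
Proof.
rewrite /Phi Phi11_halfE /F2 (F1E _ _ _ i) (F1E _ _ _ j) (f2vecE i) (f2vecE j).
rewrite VtTE VtE; congr mx22.
(* Generalizing the atoms keeps [ring] from unfolding derivatives to compare them. *)
- rewrite diag4_form; apply: eq_bigr => n _.
  by move: (coef v n) (y1 i n) (y2 j n) => *; ring.
- rewrite diag4_form; apply: eq_bigr => n _.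
  by move: (coef v n) (y1 j n) (y2 i n) => *; ring.
- rewrite diag2_form; apply: eq_bigr => n _.
  by move: (coef v n) (y2 i n) (y2 j n) => *; ring.
Qed.

Lemma PsiE i j : Psi f x theta i j =
  mx22 (hdot y0 i j * phi11h y1 v v i j) (psi12 y0 y1 v i j) (psi12 y0 y1 v j i) (psi22 y1 i j).
Proof.
rewrite /Psi -[scalar_of (Vt *m _ *m _ *m Vt^T)]/(Phi11_half f x theta i j).
rewrite Phi11_halfE fdot_hdot !F1E VtTE VtE !fvecE !f1vecE !tr_col !diag2_form dot_form.
congr mx22; apply: eq_bigr => n _.
- by move: (coef v n) (y0 i n) (y1 i n) (y1 j n) => *; ring.
- by move: (coef v n) (y0 j n) (y1 i n) (y1 j n) => *; ring.
Qed.

Lemma ePhiE i j k : ePhi f x theta i j k 0 =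
  2 * phi11h y1 v v i j * phi11h y1 v (e k) i j.
Proof.
rewrite [LHS]mxE Phi11_halfE; congr (_ * _).
rewrite /f1vec0 (f1vecE i) (f1vecE j) hadamard_form /Vmx trmxK.
by apply: eq_bigr => n _; rewrite mulrCA mulrA [y1 j n * _]mulrC.
Qed.

(** The factor 3 and the squared weights come from differentiating the cubes in [phi12]. *)
Lemma fPhiE i j k : fPhi f x theta i j k 0 = dphi12 y1 y2 v (e k) i j.
Proof.
rewrite [LHS]mxE /f1vec0 /f2vec0 (f1vecE i) (f2vecE j) hadamard_sq_form /Vmx trmxK.
rewrite mulr_sumr; apply: eq_bigr => n _.
by move: (y1 i n) (y2 j n) (coef v n) => *; ring.
Qed.

Lemma gPhiE i j k : gPhi f x theta i j k 0 = phi22 y2 v (e k) i j.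
Proof.
rewrite /gPhi /f2vec0 (f2vecE i) (f2vecE j) hadamard_form /Vmx trmxK.
by apply: eq_bigr => n _; rewrite mulrCA mulrA.
Qed.

Lemma F10_diag (u s : 'I_N -> R) i k :
  (F10 f (y i) *m diagc (\col_n u n) *m \col_n s n) k 0 =
  \sum_n coef (e k) n * (y1 i n * u n * s n).
Proof. by rewrite /F10 F1E padded_diag_form. Qed.

Lemma ePsiE i j k : ePsi f x theta i j k 0 = hdot y0 i j * phi11h y1 v (e k) i j.
Proof.
rewrite [LHS]mxE fdot_hdot VtTE F1E F10_diag; congr (_ * _).
by apply: eq_bigr => n _; move: (y1 i n) (y1 j n) (coef v n) => *; ring.
Qed.

Lemma fPsiE i j k : fPsi f x theta i j k 0 = psi12 y0 y1 (e k) i j.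
Proof.
rewrite /fPsi fvecE (F1E _ _ _ j) F10_diag; apply: eq_bigr => n _.
by congr (_ * _); rewrite mulrC mulrA.
Qed.

Lemma mul_haug_form i k (s : 'cV[R]_2) (A : 'M[R]_2) (o : 'cV[R]_2) (a : R) :
  s^T *m A *m o = a%:M ->
  (haug (fvec f (yvec x theta i)) *m s^T *m A *m o) k 0 = logit y0 (e k) i * a.
Proof.
move=> sAo; rewrite -!mulmxA (mulmxA s^T) sAo mul_mx_scalar mxE haug_logit.
exact: mulrC.
Qed.

(** The third column of [KPhi] is zero because the derivative of the (2,1) entry, with weight
    delta_i s'_j, is counted in the second column of the exchanged pair. *)
Lemma CPhiE i j k : CPhi f x q theta i j k 0 = xdot x i j ^+ 2 *
  (2 * phi11h y1 v v i j * phi11h y1 v (e k) i j * (slope y0 v i * slope y0 v j)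
   + dphi12 y1 y2 v (e k) i j * (slope y0 v i * resid y0 q01 v j)
   + phi22 y2 v (e k) i j * (resid y0 q01 v i * resid y0 q01 v j)).
Proof.
rewrite [LHS]mxE cols4_tens ePhiE fPhiE gPhiE !sig1_slope !delta_resid.
by rewrite [(0 : 'cV[R]_(1 + N)) k 0]mxE mul0r addr0.
Qed.

Lemma CPsiE i j k : CPsi f x q theta i j k 0 = 2 * xdot x i j *
  (hdot y0 i j * phi11h y1 v (e k) i j * (slope y0 v i * slope y0 v j)
   + psi12 y0 y1 (e k) i j * (slope y0 v i * resid y0 q01 v j)).
Proof.
rewrite [LHS]mxE cols4_tens ePsiE fPsiE !sig1_slope !delta_resid.
by rewrite [(0 : 'cV[R]_(1 + N)) k 0]mxE !mul0r !addr0.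
Qed.

Lemma COmegaE i j k : COmega f x theta i j k 0 =
  slope2 y0 v i * slope y0 v j * hdot y0 i j ^+ 2 * logit y0 (e k) i.
Proof. by rewrite [LHS]mxE haug_logit sig2_slope2 sig1_slope fdot_hdot. Qed.

Lemma DPhiE i j k : DPhi f x q theta i j k 0 = xdot x i j ^+ 2 * (logit y0 (e k) i *
  ((slope2 y0 v i * phi11h y1 v v i j ^+ 2 + slope y0 v i * phi12 y1 y2 v j i) * slope y0 v j
   + (slope2 y0 v i * phi12 y1 y2 v i j + slope y0 v i * phi22 y2 v v i j)
     * resid y0 q01 v j)).
Proof.
rewrite [LHS]mxE PhiE (mul_haug_form _ _ (mx22_form _ _ _ _ _ _ _ _)).
by rewrite !sig1_slope sig2_slope2 delta_resid.
Qed.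

Lemma DPsiE i j k : DPsi f x q theta i j k 0 = 2 * xdot x i j * (logit y0 (e k) i *
  ((slope2 y0 v i * (hdot y0 i j * phi11h y1 v v i j) + slope y0 v i * psi12 y0 y1 v j i)
     * slope y0 v j
   + (slope2 y0 v i * psi12 y0 y1 v i j + slope y0 v i * psi22 y1 i j)
     * resid y0 q01 v j)).
Proof.
rewrite [LHS]mxE PsiE (mul_haug_form _ _ (mx22_form _ _ _ _ _ _ _ _)).
by rewrite !sig1_slope sig2_slope2 delta_resid.
Qed.

(** [CPhi] and [CPsi] differentiate the polynomials in Vtilde; [DPhi], [DPsi] and [COmega]
    differentiate the weights s'(z_i) and delta_i through z_i. *)
Lemma gradient_entryE i j k :
  (VPhi f x q theta i j + VPsi f x q theta i j + VOmega f x theta i j) k 0 =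
  half_term y0 y1 y2 (xdot x) q01 v (e k) i j.
Proof.
rewrite [LHS]mxE [X in X + _]mxE [VPhi _ _ _ _ _ _ _ _]mxE [VPsi _ _ _ _ _ _ _ _]mxE.
by rewrite /VOmega /DOmega addr0 CPhiE DPhiE CPsiE DPsiE COmegaE.
Qed.

End GradientEntries.

(** * The gradient in the output parameters, assembled entrywise *)

Unset Implicit Arguments.

Theorem theorem5 (R : realType) (M N nI : nat)
    (M_ge1 : (1 <= M)%N) (N_ge1 : (1 <= N)%N) (nI_ge1 : (1 <= nI)%N)
    (f : R -> R) (f_diff : thrice_differentiable f)
    (x : 'I_nI -> 'cV[R]_M) (q : 'I_nI -> bool)
    (theta : 'cV[R]_((1 + M) * N + (1 + N))) :
  is_gradient
    (fun v : 'cV[R]_(1 + N) =>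
       tr_sq_hessian_loss f x q (col_mx (wpart theta) v))
    (vpart theta)
    (2 *: \sum_(i < nI) \sum_(j < nI)
       (VPhi f x q theta i j + VPsi f x q theta i j + VOmega f x theta i j)).
Proof.
move=> k.
have -> : (fun v => tr_sq_hessian_loss f x q (col_mx (wpart theta) v)) =
    fun v => \sum_i \sum_j trace_term (fun i n => f (ycoef x theta i n))
      (fun i n => (f^`())%classic (ycoef x theta i n))
      (fun i n => (f^`(2))%classic (ycoef x theta i n))
      (xdot x) (fun i => (q i)%:R) v i j.
  apply/funext => v; rewrite (tr_sq_hessian_lossE f_diff) /vpart col_mxKd.
  (* Replacing only the output block keeps W, hence every y_i, fixed. *)
  have -> // : ycoef x (col_mx (wpart theta) v) = ycoef x theta.
  apply/funext => i; apply/funext => n.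
  by rewrite /ycoef /yvec /Wmx {1}/wpart col_mxKu.
apply: (is_derive_eq (is_derive_trace _ _ _ _ (@xdotC R M nI x) _ _)).
rewrite [RHS]mxE summxE; congr (_ * _); apply: eq_bigr => i _.
by rewrite summxE; apply: eq_bigr => j _; rewrite gradient_entryE.
Qed.
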